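(* An evolutionary network is level-1 if and only if it is 1-nested and no hybrid node of it is the split node of a reticulation cycle.
   Context: An evolutionary network is a rooted directed acyclic graph whose leaves are bijectively labeled by a set of taxa. A tree node is a node of in-degree at most 1; a hybrid node is a node of in-degree at least 2. A reticulation cycle for a hybrid node $h$ is a pair of distinct non-trivial directed paths with a common origin (the split node), both ending in $h$ (the end), that have no intermediate (non-endpoint) nodes in common; the intermediate nodes of the reticulation cycle are the intermediate nodes of these two paths. A network is 1-nested when every pair of reticulation cycles with different ends have disjoint sets of intermediate nodes. A subgraph is biconnected if it is biconnected in the underlying undirected graph (connected, and remains connected after deleting any single node with its incident edges). A network is level-1 when no biconnected subgraph of it contains more than one hybrid node. No restriction on node degrees is imposed. *)

(* Defs.v *)
From mathcomp Require Import all_boot.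

Set Implicit Arguments.
Unset Strict Implicit.
Unset Printing Implicit Defensive.

Section Digraph.

Variables (V : finType) (arc : rel V).

Definition indeg (v : V) : nat := #|[set u | arc u v]|.
Definition outdeg (v : V) : nat := #|[set w | arc v w]|.
Definition leaf (v : V) : bool := outdeg v == 0.

Definition acyclic : Prop := forall c : seq V, cycle arc c -> c = [::].
Definition rooted : Prop := exists! r : V, indeg r = 0.

(* A directed path from s to t is given by the list p of its intermediate     *)
(* nodes; it has size p + 1 >= 1 arcs, so it is never trivial.                *)
Definition dipath (s t : V) (p : seq V) : bool := path arc s (rcons p t).

(* A subgraph is a set W of nodes together with a set F of arcs; it need not  *)
(* be an induced subgraph.                                                    *)
Definition subgraph (W : {set V}) (F : {set V * V}) : Prop :=
  forall u v, (u, v) \in F -> [/\ u \in W, v \in W & arc u v].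

End Digraph.

Section Biconnected.

Variable V : finType.
Implicit Types (W : {set V}) (F : {set V * V}).

Definition uadj F : rel V := [rel u v | ((u, v) \in F) || ((v, u) \in F)].

(* For a subgraph (W, F), F only joins nodes of W, so that walks starting in  *)
(* W stay in W.                                                               *)
Definition uconnected W F : Prop := {in W &, forall x y, connect (uadj F) x y}.

Definition del_arcs F (x : V) : {set V * V} :=
  [set e in F | (e.1 != x) && (e.2 != x)].

Definition biconnected W F : Prop :=
  uconnected W F /\ {in W, forall x, uconnected (W :\ x) (del_arcs F x)}.

End Biconnected.

Record network (S : Type) := Network {
  node : finType;
  arc : rel node;
  _ : acyclic arc;
  _ : rooted arc;
  label : {v : node | leaf arc v} -> S;
  _ : bijective label
}.

Section Network.

Variables (S : Type) (N : network S).

Definition hybrid (v : node N) : bool := 2 <= indeg (@arc S N) v.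

(* s is the split node, h the end, and the intermediate nodes are p ++ q. *)
Definition reticulation_cycle (s h : node N) (p q : seq (node N)) : Prop :=
  [/\ hybrid h, dipath (@arc S N) s h p, dipath (@arc S N) s h q,
      p != q & ~~ has (mem p) q].

Definition one_nested : Prop :=
  forall s1 h1 p1 q1 s2 h2 p2 q2,
    reticulation_cycle s1 h1 p1 q1 -> reticulation_cycle s2 h2 p2 q2 ->
    h1 != h2 -> ~~ has (mem (p1 ++ q1)) (p2 ++ q2).

Definition split_node (s : node N) : Prop :=
  exists h p q, reticulation_cycle s h p q.

Definition level1 : Prop :=
  forall (W : {set node N}) (F : {set node N * node N}),
    subgraph (@arc S N) W F -> biconnected W F ->
    #|[set v in W | hybrid v]| <= 1.

End Network.

(* Main.v *)
(** If the network is level-1, a reticulation cycle induces a biconnected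
    subgraph, so its end is its only hybrid node; in particular its split node
    is not hybrid.  If two cycles share an intermediate node x, then x is not
    hybrid, so both contain the unique parent of x; having two common nodes,
    their union is biconnected, and hence their ends coincide.

    Conversely, if z reaches w and some path from the root to w avoids z, then
    z is intermediate in a reticulation cycle whose end lies on both paths.  In
    a 1-nested network this implies that a hybrid node lies on every root path
    to each of its descendants, and that each hybrid node v has a cycle whose
    split node s lies on every root path to v.  Let K be the set of nodes
    reachable from the nodes strictly below s and above v.  Except at s, K is
    closed under arcs in both directions, so deleting s separates v from the
    nodes outside K.  For two hybrid nodes u and v, one may assume that the
    split node of v is not strictly above that of u, and then u is not in K.
    Since u, being hybrid, is not the split node s, no biconnected subgraph
    contains both u and v. *)

Require Import Defs.
From mathcomp Require Import all_boot.

Set Implicit Arguments.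
Unset Strict Implicit.
Unset Printing Implicit Defensive.

(** * Acyclic digraphs *)

Section AcyclicDigraph.

Variables (V : finType) (arc : rel V).
Hypothesis arc_acyclic : acyclic arc.

Lemma acyclic_path_uniq x p : path arc x p -> uniq (x :: p).
Proof.
elim: p x => [//|y p IHp] x xp.
have /= -> := IHp y (andP xp).2; rewrite andbT.
apply/negP => x_yp; case/splitPr: x_yp xp => p1 p2.
rewrite cat_path /= => /and3P[xp1 p1x _].
by have /arc_acyclic : cycle arc (x :: p1) by rewrite /= rcons_path xp1.
Qed.

Lemma acyclic_connect_anti x y : connect arc x y -> connect arc y x -> x = y.
Proof.
case/connectP=> p xp y_def /connectP[q yq x_def].
have: uniq (x :: p ++ q).
  by apply: acyclic_path_uniq; rewrite cat_path xp -y_def.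
case: q yq x_def => [//|z q] _ x_def /=; rewrite mem_cat negb_or.
by rewrite {2}x_def /= mem_last andbF.
Qed.

Lemma acyclic_arcF x y : arc x y -> connect arc y x = false.
Proof.
move=> xy; apply/negP=> yx.
have exy : x = y by apply: acyclic_connect_anti; first exact: connect1.
by have /arc_acyclic : cycle arc [:: x] by rewrite /= {2}exy xy.
Qed.

Lemma connect_path x p y : path arc x p -> y \in x :: p -> connect arc x y.
Proof.
move=> xp /splitPl y_xp; case: y_xp xp => p1 p2 y_def.
by rewrite cat_path => /andP[xp1 _]; apply/connectP; exists p1.
Qed.

Lemma connect_path_last x p y :
  path arc x p -> y \in x :: p -> connect arc y (last x p).
Proof.
move=> xp /splitPl y_xp; case: y_xp xp => p1 p2 y_def.
rewrite cat_path last_cat y_def => /andP[_ yp2].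
by apply/connectP; exists p2.
Qed.

Lemma rooted_connect r x :
  (forall y, indeg arc y = 0 -> r = y) -> connect arc r x.
Proof.
move=> r_uniq; pose anc x := [set y | connect arc y x].
have [n] := ubnP #|anc x|; elim: n x => // n IHn x; rewrite ltnS => leAn.
have [/r_uniq-> //|] := eqVneq (indeg arc x) 0.
rewrite cards_eq0 => /set0Pn[y]; rewrite inE => yx.
apply: connect_trans (IHn y _) (connect1 yx).
apply: leq_trans (proper_card _) leAn; apply/properP; split.
  by apply/subsetP=> t; rewrite !inE => /connect_trans-> //; apply: connect1.
by exists x; rewrite inE // acyclic_arcF.
Qed.

End AcyclicDigraph.

Lemma first_meet (T : eqType) (s t : seq T) : has (mem t) s ->
  exists s1 x s2, [/\ s = s1 ++ x :: s2, x \in t & ~~ has (mem t) s1].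
Proof.
elim: s => //= x s IHs; have [x_t _|x_t /= /IHs] := boolP (x \in t).
  by exists [::], x, s.
case=> s1 [y [s2 [-> y_t s1_t]]].
by exists (x :: s1), y, s2; rewrite /= negb_or x_t.
Qed.

Lemma last_meet (T : eqType) (s t : seq T) : has (mem t) s ->
  exists s1 x s2, [/\ s = s1 ++ x :: s2, x \in t & ~~ has (mem t) s2].
Proof.
rewrite -has_rev => /first_meet[s1 [x [s2 [es x_t s1_t]]]].
exists (rev s2), x, (rev s1); split=> //; last by rewrite has_rev.
by rewrite -[s]revK es rev_cat rev_cons cat_rcons.
Qed.

(** * Biconnected induced subgraphs *)

Section Induced.

Variables (V : finType) (arc : rel V).
Implicit Types A B W : {set V}.

Definition induced_arcs W : {set V * V} :=
  [set e | [&& arc e.1 e.2, e.1 \in W & e.2 \in W]].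

Lemma induced_subgraph W : subgraph arc W (induced_arcs W).
Proof. by move=> u v; rewrite inE => /and3P[]. Qed.

Lemma del_induced_arcs W x : del_arcs (induced_arcs W) x = induced_arcs (W :\ x).
Proof.
apply/setP=> -[u v]; rewrite !inE /=.
by case: (arc u v); case: (u == x); case: (v == x); rewrite ?andbF ?andbT.
Qed.

Definition uconn W := uconnected W (induced_arcs W).

Lemma uconn_path W x p : path arc x p -> {subset x :: p <= W} ->
  {in x :: p, forall y, connect (uadj (induced_arcs W)) x y}.
Proof.
elim: p x => [|z p IHp] x; first by move=> _ _ y; rewrite inE => /eqP->.
move=> /= /andP[xz zp] pW y; rewrite inE => /predU1P[-> //|y_zp].
apply: connect_trans (IHp z zp _ y y_zp); last first.
  by move=> t t_zp; apply: pW; rewrite inE t_zp orbT.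
by apply: connect1; rewrite /uadj /= inE /= xz !pW ?inE ?eqxx ?orbT.
Qed.

Lemma uadj_connect_sym (F : {set V * V}) : connect_sym (uadj F).
Proof. by apply: sym_connect_sym => x y; apply: orbC. Qed.

Lemma uconn_pathset x p : path arc x p -> uconn [set y in x :: p].
Proof.
move=> xp y z; rewrite !in_set => y_p z_p.
have pW : {subset x :: p <= [set y in x :: p]} by move=> t; rewrite in_set.
apply: (@connect_trans _ _ x).
  by rewrite uadj_connect_sym; apply: uconn_path pW _ _.
by apply: uconn_path pW _ _.
Qed.

Lemma sub_induced_connect A B x y : A \subset B ->
  connect (uadj (induced_arcs A)) x y -> connect (uadj (induced_arcs B)) x y.
Proof.
move/subsetP=> sAB; apply: connect_sub => u v uv; apply: connect1.
move: uv; rewrite /uadj /= !inE /= => /orP[]/and3P[-> uA vA];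
  by rewrite !sAB ?orbT.
Qed.

Lemma uconnU A B x : x \in A -> x \in B -> uconn A -> uconn B -> uconn (A :|: B).
Proof.
move=> xA xB cA cB.
have to_x y : y \in A :|: B -> connect (uadj (induced_arcs (A :|: B))) y x.
  case/setUP=> [yA|yB].
    by apply: sub_induced_connect (subsetUl _ _) (cA _ _ yA xA).
  by apply: sub_induced_connect (subsetUr _ _) (cB _ _ yB xB).
move=> y z yAB zAB; apply: connect_trans (to_x y yAB) _.
by rewrite uadj_connect_sym to_x.
Qed.

Lemma induced_biconnected W : uconn W -> (forall x, uconn (W :\ x)) ->
  biconnected W (induced_arcs W).
Proof. by move=> cW cWD; split=> // x _; rewrite del_induced_arcs; apply: cWD. Qed.

Definition cycle_nodes (s h : V) (p q : seq V) : {set V} :=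
  [set x in s :: rcons p h] :|: [set x in s :: rcons q h].

Hypothesis arc_acyclic : acyclic arc.

Lemma cycle_nodes_uconn s h p q : dipath arc s h p -> dipath arc s h q ->
  uconn (cycle_nodes s h p q).
Proof.
by move=> sp sq; apply: (@uconnU _ _ s); rewrite ?inE ?eqxx //; apply: uconn_pathset.
Qed.

Lemma cycle_nodesC s h p q : cycle_nodes s h p q = cycle_nodes s h q p.
Proof. exact: setUC. Qed.

Lemma uconn0 : uconn set0. Proof. by move=> x y; rewrite inE. Qed.

Lemma uconn_dipath_del s h p x : dipath arc s h p -> x \notin p ->
  uconn ([set y in s :: rcons p h] :\ x).
Proof.
move=> sp x_p; have := acyclic_path_uniq arc_acyclic sp.
have [->|xs] := eqVneq x s => sph_uniq.
  have -> : [set y in s :: rcons p h] :\ s = [set y in rcons p h].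
    apply/setP=> y; rewrite !inE; case: eqVneq => // ->.
    by apply/esym/negbTE; case/andP: sph_uniq.
  move: sp; rewrite /dipath; case: (rcons p h) => [_|y l /= /andP[_]].
    have -> : [set y in [::]] = set0 :> {set V} by apply/setP=> y; rewrite !inE.
    exact: uconn0.
  exact: uconn_pathset.
have [->|xh] := eqVneq x h.
  have -> : [set y in s :: rcons p h] :\ h = [set y in s :: p].
    apply/setP=> y; rewrite !inE mem_rcons inE; case: eqVneq => // ->.
    move: sph_uniq; rewrite -rcons_cons rcons_uniq inE negb_or.
    by case/andP=> /andP[/negbTE-> /negbTE->].
  by apply: uconn_pathset; move: sp; rewrite /dipath rcons_path => /andP[].
have -> : [set y in s :: rcons p h] :\ x = [set y in s :: rcons p h].
  apply/setP=> y; rewrite !inE mem_rcons inE; case: eqVneq => // ->.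
  by rewrite (negbTE xs) (negbTE xh) (negbTE x_p).
exact: uconn_pathset.
Qed.

Lemma uconn_dipath_del_mem s h p q x : dipath arc s h p -> dipath arc s h q ->
  x \in p -> x \notin q -> uconn (cycle_nodes s h p q :\ x).
Proof.
move=> sp sq x_p x_q; case/splitPr: x_p sp => p1 p2 sp.
have := acyclic_path_uniq arc_acyclic sp; move: sp.
rewrite /dipath rcons_cat rcons_cons cat_path /=.
case/and3P=> sp1 _ xp2 /andP[s_p]; rewrite cat_uniq /= negb_or.
case/and4P=> _ /andP[x_p1 _] x_p2 _.
have xs : x != s by apply: contraNneq s_p => <-; rewrite mem_cat inE eqxx orbT.
have xh : x != h by apply: contraNneq x_p2 => ->; rewrite mem_rcons inE eqxx.
have -> : cycle_nodes s h (p1 ++ x :: p2) q :\ x =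
    ([set y in s :: rcons q h] :|: [set y in s :: p1]) :|: [set y in rcons p2 h].
  apply/setP=> y; rewrite !inE rcons_cat rcons_cons mem_cat inE.
  case: (eqVneq y x) => [->|yx] /=.
    rewrite mem_rcons inE (negbTE xs) (negbTE xh).
    by rewrite (negbTE x_p1) (negbTE x_p2) (negbTE x_q).
  case: (y == s); case: (y \in p1); case: (y \in rcons p2 h);
    by case: (y \in rcons q h).
apply: (@uconnU _ _ h); rewrite ?inE ?mem_rcons ?inE ?eqxx ?orbT //.
  apply: (@uconnU _ _ s); rewrite ?inE ?eqxx //; exact: uconn_pathset.
move: xp2; case: (rcons p2 h) => [_ a b|y l /= /andP[_]]; first by rewrite !inE.
exact: uconn_pathset.
Qed.

Lemma cycle_nodes_uconn_del s h p q x :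
  dipath arc s h p -> dipath arc s h q -> ~~ has (mem p) q ->
  uconn (cycle_nodes s h p q :\ x).
Proof.
move=> sp sq /hasPn pq.
have [x_p|x_p] := boolP (x \in p).
  by apply: uconn_dipath_del_mem => //; apply/negP=> /pq /=; rewrite x_p.
have [x_q|x_q] := boolP (x \in q).
  by rewrite cycle_nodesC; apply: uconn_dipath_del_mem.
rewrite /cycle_nodes setDUl.
have sh : s != h.
  have := acyclic_path_uniq arc_acyclic sp.
  by rewrite /= mem_rcons inE negb_or => /andP[/andP[]].
have [t tx t_sh] : exists2 t, t != x & (t == s) || (t == h).
  have [sx|] := eqVneq s x; last by exists s; rewrite ?eqxx.
  by exists h; rewrite ?eqxx ?orbT // -sx eq_sym.
apply: (@uconnU _ _ t); try exact: uconn_dipath_del.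
  by rewrite !inE mem_rcons inE tx /= orbA t_sh.
by rewrite !inE mem_rcons inE tx /= orbA t_sh.
Qed.

Lemma uconnU_del A B x y : x != y -> x \in A :&: B -> y \in A :&: B ->
  uconn A -> uconn B ->
  (forall t, uconn (A :\ t)) -> (forall t, uconn (B :\ t)) ->
  biconnected (A :|: B) (induced_arcs (A :|: B)).
Proof.
move=> xy /setIP[xA xB] /setIP[yA yB] cA cB cAD cBD.
apply: induced_biconnected; first exact: (uconnU xA xB).
move=> t; rewrite setDUl; have [->|tx] := eqVneq t x.
  by apply: (@uconnU _ _ y); rewrite // !inE eq_sym xy.
by apply: (@uconnU _ _ x); rewrite // !inE eq_sym tx.
Qed.

End Induced.

(** * Reticulation cycles *)

Section ReticulationCycles.

Variables (S : Type) (N : network S).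
Local Notation V := (node N).
Local Notation A := (@Defs.arc S N).
Implicit Types (s h u v w x y z : V) (p q P Q R : seq V).

Hypothesis A_acyclic : acyclic A.

Let connect_anti := acyclic_connect_anti A_acyclic.

Lemma reticulation_cycleC s h p q :
  reticulation_cycle s h p q -> reticulation_cycle s h q p.
Proof. by case=> hh sp sq pq dpq; split; rewrite // 1?eq_sym 1?has_sym. Qed.

Lemma hybridP h : reflect (exists x y, [/\ A x h, A y h & x != y]) (hybrid h).
Proof.
apply: (iffP card_gt1P) => -[x [y]].
  by rewrite !inE => -[xh yh xy]; exists x, y.
by case=> xh yh xy; exists x, y; rewrite !inE.
Qed.

Lemma dipath_connect s h p z : dipath A s h p -> z \in p ->
  [/\ connect A s z, s != z, connect A z h & z != h].
Proof.
move=> sp z_p.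
have z_ph : z \in s :: rcons p h by rewrite inE mem_rcons inE z_p !orbT.
have := connect_path_last sp z_ph; rewrite last_rcons => zh.
split=> //; first exact: connect_path z_ph.
  apply: contraTneq (acyclic_path_uniq A_acyclic sp) => ->.
  by rewrite /= mem_rcons inE z_p orbT.
apply: contraTneq (acyclic_path_uniq A_acyclic sp) => <-.
by rewrite /= rcons_uniq z_p /= andbF.
Qed.

Lemma cycle_connect s h p q z : reticulation_cycle s h p q -> z \in p ++ q ->
  [/\ connect A s z, s != z, connect A z h & z != h].
Proof.
by case=> _ sp sq _ _; rewrite mem_cat => /orP[]; apply: dipath_connect.
Qed.

Lemma cycle_ends s h p q : reticulation_cycle s h p q -> connect A s h /\ s != h.
Proof.
case=> _ sp _ _ _; split.
  by apply: (connect_path sp); rewrite inE mem_rcons inE eqxx orbT.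
have := acyclic_path_uniq A_acyclic sp.
by rewrite /= mem_rcons inE negb_or => /andP[/andP[]].
Qed.

Lemma cycle_parent s h p q x : reticulation_cycle s h p q -> x \in p ++ q ->
  exists2 y, A y x & y \in cycle_nodes s h p q.
Proof.
wlog x_p : p q / x \in p => [IH rc|].
  rewrite mem_cat => /orP[x_p|x_q]; first by apply: IH => //; rewrite mem_cat x_p.
  rewrite cycle_nodesC; apply: IH; rewrite // ?mem_cat ?x_q //.
  exact: reticulation_cycleC.
case=> _ sp _ _ _ _; case/splitPr: x_p sp => p1 p2.
rewrite /dipath rcons_cat rcons_cons cat_path /= => /and3P[_ yx _].
exists (last s p1) => //; rewrite !inE rcons_cat mem_cat orbA.
by have := mem_last s p1; rewrite inE => /orP[]->; rewrite ?orbT.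
Qed.

Lemma nonhybrid_parent x y z : ~~ hybrid x -> A y x -> A z x -> y = z.
Proof.
by move=> /hybridP hx yx zx; have [//|yz] := eqVneq y z; case: hx; exists y, z.
Qed.

Lemma level1_eq (W : {set V}) x y : level1 N ->
  biconnected W (induced_arcs A W) ->
  x \in W -> y \in W -> hybrid x -> hybrid y -> x = y.
Proof.
move=> l1 bW xW yW hx hy.
have /card_le1_eqP := l1 _ _ (@induced_subgraph _ _ W) bW.
by apply; rewrite inE ?xW ?yW.
Qed.

Lemma cycle_biconnected s h p q : reticulation_cycle s h p q ->
  let W := cycle_nodes s h p q in
  [/\ uconn A W, forall t, uconn A (W :\ t) & biconnected W (induced_arcs A W)].
Proof.
case=> _ sp sq _ pq W.
have cW : uconn A W by apply: cycle_nodes_uconn.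
have cWD t : uconn A (W :\ t) by apply: cycle_nodes_uconn_del.
by split=> //; apply: induced_biconnected.
Qed.

Lemma mem_cycle_end s h p q : h \in cycle_nodes s h p q.
Proof. by rewrite !inE mem_rcons inE eqxx orbT. Qed.

Lemma mem_cycle_inter s h p q x : x \in p ++ q -> x \in cycle_nodes s h p q.
Proof. by rewrite mem_cat !inE !mem_rcons !inE => /orP[]->; rewrite !orbT. Qed.

Lemma level1_nosplit h : level1 N -> hybrid h -> ~ split_node h.
Proof.
move=> l1 hh [h' [p [q rc]]]; have [_ /negP[]] := cycle_ends rc.
have [_ _ bW] := cycle_biconnected rc.
have hh' : hybrid h' by case: rc.
apply/eqP; apply: level1_eq bW _ _ _ _ => //; last exact: mem_cycle_end.
by rewrite !inE eqxx.
Qed.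

Lemma level1_one_nested : level1 N -> one_nested N.
Proof.
move=> l1 s1 h1 p1 q1 s2 h2 p2 q2 rc1 rc2 /negP h12.
apply/hasPn => x x2; apply/negP => /= x1; apply: h12; apply/eqP.
have [c1 cD1 b1] := cycle_biconnected rc1.
have [c2 cD2 b2] := cycle_biconnected rc2.
have hh1 : hybrid h1 by case: rc1.
have hh2 : hybrid h2 by case: rc2.
have [hx|hx] := boolP (hybrid x).
  have [_ _ _ /eqP[]] := cycle_connect rc1 x1.
  apply: level1_eq l1 b1 _ _ hx hh1; first exact: mem_cycle_inter.
  exact: mem_cycle_end.
have [y yx y1] := cycle_parent rc1 x1; have [y' y'x y2] := cycle_parent rc2 x2.
rewrite -{y' y'x}(nonhybrid_parent hx yx y'x) in y2.
have xy : x != y.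
  apply: contraTneq yx => <-; apply/negP => /(acyclic_arcF A_acyclic).
  by rewrite connect0.
apply: (@level1_eq (cycle_nodes s1 h1 p1 q1 :|: cycle_nodes s2 h2 p2 q2)) => //.
- by apply: (@uconnU_del _ _ _ _ x y) => //; rewrite inE ?y1 ?y2 ?mem_cycle_inter.
- by rewrite inE mem_cycle_end.
- by rewrite inE mem_cycle_end orbT.
Qed.

Variable r : V.
Hypothesis root_connect : forall x, connect A r x.

(* If h is the first node of Q on P, and m the last common node of P up to h  *)
(* and of a path from r to z, then m is the split node and h the end.         *)
Lemma avoiding_path_cycle z Q P :
  path A z Q -> path A r P -> last z Q = last r P -> z \notin r :: P ->
  exists h s p q, [/\ reticulation_cycle s h p q, z \in p ++ q, h \in Q & h \in P].
Proof.
move=> zQ rP lQP z_P.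
have hQP : has (mem (r :: P)) Q.
  apply/hasP; exists (last r P); last exact: mem_last.
  have := mem_last z Q; rewrite inE lQP => /predU1P[ez|//].
  by rewrite -ez mem_last in z_P.
have [Q1 [h [Q2 [eQ h_rP Q1_P]]]] := first_meet hQP.
have zh : connect A z h.
  by apply: connect_path zQ _; rewrite inE eQ mem_cat inE eqxx !orbT.
have h_P : h \in P.
  move: h_rP; rewrite inE => /predU1P[hr|//].
  by rewrite hr in zh; rewrite -(connect_anti (root_connect z) zh) mem_head in z_P.
have [R rR zR] := connectP (root_connect z).
case/splitPr: h_P rP {h_rP hQP lQP} z_P Q1_P => P1 P2.
rewrite cat_path /= => /and3P[rP1 P1h _] z_P Q1_P.
have hR : has (mem (r :: P1)) (r :: R) by rewrite /= inE eqxx.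
have [R1 [m [R2 [eR m_P R2_P]]]] := last_meet hR.
have mR2 : path A m R2 /\ last m R2 = z.
  move: eR; case: R1 => [|r1 R1] [er eR]; first by rewrite -er -eR.
  rewrite eR in rR zR; move: rR; rewrite cat_path /= => /and3P[_ _].
  by rewrite zR last_cat.
case: mR2 => mR2 lR2.
have z_R2 : z \in R2.
  have := mem_last m R2; rewrite lR2 inE => /predU1P[ez|//].
  by case/negP: z_P; rewrite ez -cat_cons mem_cat m_P.
have [B [mB lB sB]] : exists B,
    [/\ path A m B, last m B = last r P1 & {subset B <= r :: P1}].
  case/splitPl: m_P rP1 => B1 B eB; rewrite cat_path last_cat eB => /andP[_ mB].
  by exists B; split=> // t tB; rewrite inE mem_cat tB !orbT.
have mp : dipath A m h (R2 ++ Q1).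
  rewrite /dipath rcons_cat cat_path mR2 lR2 /=.
  by move: zQ; rewrite eQ cat_path rcons_path /= => /and3P[-> ->].
have mq : dipath A m h B by rewrite /dipath rcons_path mB lB.
have disj : ~~ has (mem (r :: P1)) (R2 ++ Q1).
  rewrite has_cat negb_or R2_P; apply: contraNN Q1_P.
  by apply: sub_has => t /= t_P; rewrite -cat_cons mem_cat t_P.
have dB : ~~ has (mem (R2 ++ Q1)) B.
  apply/hasPn => t /sB t_P; apply: contraNN disj => /= t_RQ.
  by apply/hasP; exists t.
exists h, m, (R2 ++ Q1), B.
split; try by rewrite ?eQ !mem_cat ?z_R2 ?inE ?eqxx ?orbT.
split=> //; last first.
  apply: contraNneq dB => <-; apply/hasP; exists z; rewrite /= mem_cat z_R2 //.
apply/hybridP; exists (last m (R2 ++ Q1)), (last r P1); split=> //.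
  by move: mp; rewrite /dipath rcons_path => /andP[].
apply: contraNneq disj => e; apply/hasP; exists (last r P1); last exact: mem_last.
rewrite -e; case: (R2) z_R2 => //= t R3 _; exact: mem_last.
Qed.

Lemma hybrid_cycle h : hybrid h -> exists s p q, reticulation_cycle s h p q.
Proof.
case/hybridP=> x [y []]; wlog nxy : x y / ~~ connect A x y => [IH xh yh xy|xh yh xy].
  have [cxy|/IH] := boolP (connect A x y); last by apply.
  apply: (IH y x); rewrite 1?eq_sym //; apply: contra_neqN xy; exact: connect_anti.
have [P rP yP] := connectP (root_connect y).
have [||||h' [s [p [q [rc _]]]]] := @avoiding_path_cycle x [:: h] (rcons P h).
- by rewrite /= xh.
- by rewrite rcons_path rP -yP.
- by rewrite last_rcons.
- rewrite -rcons_cons mem_rcons inE negb_or; apply/andP; split.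
    apply: contraTneq xh => ->; apply/negP=> /(acyclic_arcF A_acyclic).
    by rewrite connect0.
  by apply: contraNN nxy => x_P; rewrite yP connect_path_last.
by rewrite inE => /eqP eh _; rewrite -eh; exists s, p, q.
Qed.

Definition dominates d w := forall P, path A r P -> last r P = w -> d \in r :: P.

Lemma dominates_or_avoided d w :
  dominates d w \/ exists P, [/\ path A r P, last r P = w & d \notin r :: P].
Proof.
have [->|dr] := eqVneq d r; first by left=> P _ _; rewrite mem_head.
pose e := [rel x y | A x y && (y != d)].
have pathe x P : path e x P = path A x P && (d \notin P).
  elim: P x => //= y P IHP x; rewrite IHP inE negb_or [d == y]eq_sym.
  by case: (A x y); case: (y == d); rewrite ?andbF.
case: (boolP (connect e r w)) => [/connectP[P]|nrw].
  rewrite pathe => /andP[rP dP] wP; right; exists P.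
  by rewrite inE negb_or dr.
left=> P rP wP; apply: contraNT nrw; rewrite inE negb_or => /andP[_ dP].
by apply/connectP; exists P; rewrite // pathe rP.
Qed.

Lemma dominates_split d s v p q :
  reticulation_cycle s v p q -> dominates d v -> d != v -> connect A d s.
Proof.
case=> _ sp sq _ /hasPn pq dv ndv.
have [R rR sR] := connectP (root_connect s).
have d_path p' : dipath A s v p' -> ~~ connect A d s -> d \in p'.
  move=> sp' nds; have := dv (R ++ rcons p' v).
  rewrite cat_path last_cat last_rcons rR -sR => /(_ sp' erefl).
  rewrite -cat_cons mem_cat mem_rcons inE (negbTE ndv) => /orP[d_R|//].
  by case/negP: nds; rewrite sR connect_path_last.
apply: contraT => nds; have /pq /= := d_path q sq nds.
by rewrite d_path.
Qed.

Hypothesis nested : one_nested N.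

Lemma nested_end s1 h1 p1 q1 s2 h2 p2 q2 z :
  reticulation_cycle s1 h1 p1 q1 -> reticulation_cycle s2 h2 p2 q2 ->
  z \in p1 ++ q1 -> z \in p2 ++ q2 -> h1 = h2.
Proof.
move=> rc1 rc2 z1 z2; apply/eqP; apply: contraT => /(nested rc1 rc2)/hasPn/(_ _ z2).
by rewrite /= z1.
Qed.

Lemma hybrid_dominates u v : hybrid u -> connect A u v -> dominates u v.
Proof.
case/hybrid_cycle=> s [p [q rc]] /connectP[Q uQ vQ] P rP vP.
apply: contraT => u_P.
have [x x_pq] : exists x, x \in p ++ q.
  case: rc => _ _ _ npq _; case: p q npq => [|x p] [|y q] // _.
  - by exists y; rewrite mem_head.
  - by exists x; rewrite mem_head.
  - by exists x; rewrite mem_head.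
wlog x_p : p q rc x_pq / x \in p => [IH|].
  have /orP[x_p|x_q] : (x \in p) || (x \in q) by rewrite -mem_cat.
    exact: (IH p q).
  by apply: (IH q p) => //; [exact: reticulation_cycleC|rewrite mem_cat x_q].
(* u is not on P, so such a cycle has another end than the cycle of u.        *)
suff [h [s' [p' [q' [rc' x' h_P]]]]] : exists h s' p' q',
    [/\ reticulation_cycle s' h p' q', x \in p' ++ q' & h \in P].
  by rewrite (nested_end rc rc' x_pq x') inE h_P orbT in u_P.
have [sx nsx xu nxu] := cycle_connect rc x_pq.
have [_ sp sq _ /hasPn pq] := rc.
have [x_P|x_P] := boolP (x \in r :: P).
  case/splitPl: x_P rP vP {u_P} => P1 P2 eP1.
  rewrite cat_path last_cat eP1 => /andP[_ xP2] lP2.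
  have [R rR sR] := connectP (root_connect s).
  have [||||h [s' [p' [q' [rc' x' h_P _]]]]] :=
    @avoiding_path_cycle x P2 (R ++ rcons q u ++ Q) => //.
  - by rewrite !cat_path rR -sR last_rcons uQ andbT.
  - by rewrite !last_cat last_rcons -vQ.
  - rewrite -cat_cons !mem_cat mem_rcons [x \in u :: q]in_cons (negbTE nxu) /=.
    apply/negP=> /or3P[x_R|x_q|x_Q].
    + case/negP: nsx; apply/eqP; apply: connect_anti => //.
      by rewrite sR; apply: connect_path_last rR x_R.
    + by have /= := pq _ x_q; rewrite x_p.
    + case/negP: nxu; apply/eqP; apply: connect_anti => //.
      by apply: connect_path uQ _; rewrite inE x_Q orbT.
  by exists h, s', p', q'; split; rewrite // mem_cat h_P orbT.
case/splitPr: x_p sp => p1 p2.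
rewrite /dipath rcons_cat rcons_cons cat_path /= => /and3P[_ _ xp2].
have [||||h [s' [p' [q' [rc' x' _ h_P]]]]] :=
  @avoiding_path_cycle x (rcons p2 u ++ Q) P => //.
- by rewrite cat_path xp2 last_rcons.
- by rewrite last_cat last_rcons -vQ.
by exists h, s', p', q'.
Qed.

Lemma between_intermediate s v p q z : reticulation_cycle s v p q ->
  connect A s z -> s != z -> connect A z v -> z != v ->
  exists s' p' q', reticulation_cycle s' v p' q' /\ z \in p' ++ q'.
Proof.
move=> rc sz nsz zv nzv.
have [/(dominates_split rc)/(_ nzv) zs|[P [rP vP z_P]]] := dominates_or_avoided z v.
  by case/eqP: nsz; apply: connect_anti.
have [Q zQ vQ] := connectP zv.
have [||||h [s' [p' [q' [rc' z' h_Q _]]]]] := @avoiding_path_cycle z Q P => //.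
  by rewrite -vQ.
have [eh|nhv] := eqVneq h v; first by exists s', p', q'; rewrite -eh.
have zh : connect A z h by apply: connect_path zQ _; rewrite inE h_Q orbT.
have hv : connect A h v.
  by rewrite vQ; apply: connect_path_last; rewrite // inE h_Q orbT.
have hh : hybrid h by case: rc'.
have hs := dominates_split rc (hybrid_dominates hh hv) nhv.
by case/eqP: nsz; apply: connect_anti => //; apply: connect_trans zh hs.
Qed.

Lemma dominating_split v : hybrid v ->
  exists s p q, reticulation_cycle s v p q /\ dominates s v.
Proof.
case/hybrid_cycle=> s0 [p0 [q0 rc0]].
pose anc x := [set y | connect A y x].
have [n] := ubnP #|anc s0|; elim: n s0 p0 q0 rc0 => // n IHn s p q rc.
rewrite ltnS => leAn.
have [sv|[P [rP vP s_P]]] := dominates_or_avoided s v; first by exists s, p, q.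
have [_ sp _ _ _] := rc.
have [||||h [s' [p' [q' [rc' s_pq h_Q h_P]]]]] :=
  @avoiding_path_cycle s (rcons p v) P => //; first by rewrite last_rcons.
have [s's ns's _ _] := cycle_connect rc' s_pq.
have ehv : h = v.
  move: h_Q; rewrite mem_rcons inE => /predU1P[//|h_p].
  have [sh nsh hv nhv] := dipath_connect sp h_p.
  have hh : hybrid h by case: rc'.
  case/eqP: nsh; apply: connect_anti => //.
  exact: dominates_split rc (hybrid_dominates hh hv) nhv.
rewrite ehv in rc'; apply: IHn rc' _.
apply: leq_trans (proper_card _) leAn; apply/properP; split.
  by apply/subsetP=> t; rewrite !inE => /connect_trans->.
exists s; rewrite !inE //; apply: contraNN ns's => ss'.
by apply/eqP/connect_anti.
Qed.

(* The nodes that stay on the side of v when its split node s is deleted. *)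
Definition cycle_side s v : {set V} := [set w |
  [exists z, [&& connect A s z, s != z, connect A z v & connect A z w]]].

Lemma cycle_sideP s v w :
  reflect (exists z, [/\ connect A s z, s != z, connect A z v & connect A z w])
          (w \in cycle_side s v).
Proof. by rewrite inE; apply: (iffP existsP) => -[z /and4P]; exists z. Qed.

Lemma cycle_side_entry s v p q z w P : reticulation_cycle s v p q ->
  connect A s z -> s != z -> connect A z v -> connect A z w ->
  path A r P -> last r P = w -> (z \in r :: P) || (v \in r :: P).
Proof.
move=> rc sz nsz zv zw rP wP; have hv : hybrid v by case: rc.
have [ezv|nzv] := eqVneq z v.
  by rewrite ezv in zw; rewrite (hybrid_dominates hv zw rP wP) orbT.
have [//|z_P] := boolP (z \in r :: P).
have [s1 [p1 [q1 [rc1 z1]]]] := between_intermediate rc sz nsz zv nzv.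
have [Q zQ wQ] := connectP zw.
have [||||h [s2 [p2 [q2 [rc2 z2 _ h_P]]]]] := @avoiding_path_cycle z Q P => //.
  by rewrite -wQ.
by rewrite (nested_end rc1 rc2 z1 z2) inE h_P orbT.
Qed.

Lemma cycle_side_arc s v p q y w : reticulation_cycle s v p q -> dominates s v ->
  A y w -> y != s -> w \in cycle_side s v -> y \in cycle_side s v.
Proof.
move=> rc dsv yw nys /cycle_sideP[z [sz nsz zv zw]].
have [R rR yR] := connectP (root_connect y).
have rRw : path A r (rcons R w) by rewrite rcons_path rR -yR.
have [sv nsv] := cycle_ends rc.
have side t : t \in r :: R -> connect A s t -> s != t -> connect A t v ->
    y \in cycle_side s v.
  move=> t_R st nst tv; apply/cycle_sideP; exists t; split=> //.
  by rewrite yR connect_path_last.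
have side_w : connect A s w -> s != w -> connect A w v -> y \in cycle_side s v.
  move=> sw nsw /connectP[Q wQ vQ].
  have yv : connect A y v.
    by apply: connect_trans (connect1 yw) _; apply/connectP; exists Q.
  have := dsv (rcons R w ++ Q).
  rewrite cat_path rRw last_cat last_rcons -vQ => /(_ wQ erefl).
  rewrite cat_rcons -cat_cons mem_cat => /orP[s_R|s_Q].
    apply/cycle_sideP; exists y; split; rewrite // 1?eq_sym //.
    by rewrite yR connect_path_last.
  by case/eqP: nsw; apply: connect_anti => //; apply: connect_path wQ _.
have := cycle_side_entry rc sz nsz zv zw rRw (last_rcons _ _ _).
rewrite -rcons_cons !mem_rcons [z \in _]in_cons [v \in _]in_cons.
case/orP=> /predU1P[e|e_R].
- by apply: side_w; rewrite -e.
- exact: (side z).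
- by apply: side_w; rewrite -e.
- exact: (side v).
Qed.

Lemma notin_cycle_side s u v p q s' p' q' :
  reticulation_cycle s v p q -> reticulation_cycle s' u p' q' -> u != v ->
  ~~ (connect A s s' && (s != s')) -> u \notin cycle_side s v.
Proof.
move=> rc rc' nuv nss'; apply/negP => /cycle_sideP[z [sz nsz zv zu]].
have hu : hybrid u by case: rc'.
have hv : hybrid v by case: rc.
have not_dom t : connect A s t -> s != t -> t != u -> ~ dominates t u.
  move=> st nst ntu /(dominates_split rc')/(_ ntu) ts'; case/negP: nss'.
  rewrite (connect_trans st ts'); apply: contraNneq nst => es.
  by apply/eqP/connect_anti; rewrite // es.
have [ezu|nzu] := eqVneq z u.
  case/eqP: nsz; apply: connect_anti => //; rewrite ezu in zv *.
  exact: dominates_split rc (hybrid_dominates hu zv) nuv.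
have [sv nsv] := cycle_ends rc.
apply: (not_dom z) => // P rP uP.
case/orP: (cycle_side_entry rc sz nsz zv zu rP uP) => // v_P.
case: (not_dom v); rewrite // 1?eq_sym //; apply: hybrid_dominates => //.
by rewrite -uP connect_path_last.
Qed.

Lemma dominating_split_separates (W : {set V}) (F : {set V * V}) s u v p q :
  subgraph A W F -> biconnected W F ->
  reticulation_cycle s v p q -> dominates s v ->
  u \in W -> v \in W -> u != s -> u \in cycle_side s v.
Proof.
move=> sF [cW cWD] rc dsv uW vW nus.
have [sv nsv] := cycle_ends rc.
have vu : connect (uadj (del_arcs F s)) v u.
  have [sW|sW] := boolP (s \in W).
    by apply: (cWD s sW); rewrite !inE ?nus // eq_sym nsv.
  suff -> : del_arcs F s = F by apply: cW.
  apply/setP=> -[x y]; rewrite inE /=; case xyF: (_ \in F) => //=.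
  have [xW yW _] := sF _ _ xyF.
  by apply/andP; split; [apply: contraNneq sW => <-|apply: contraNneq sW => <-].
have closedK : closed (uadj (del_arcs F s)) (cycle_side s v).
  apply: intro_closed; first exact: uadj_connect_sym.
  move=> x y; rewrite /uadj /= !inE /= => /orP[]/and3P[xyF nx ny].
    have [_ _ xy] := sF _ _ xyF; case/existsP=> z /and4P[sz nsz zv zx].
    apply/existsP; exists z; rewrite sz nsz zv.
    exact: connect_trans zx (connect1 xy).
  have [_ _ yx] := sF _ _ xyF => x_K; have := cycle_side_arc rc dsv yx nx.
  by rewrite !inE; apply.
rewrite -(closed_connect closedK vu).
by apply/cycle_sideP; exists v; split.
Qed.

Lemma nested_nosplit_level1 : (forall h : V, hybrid h -> ~ split_node h) -> level1 N.
Proof.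
move=> nosplit W F sF bW; rewrite leqNgt; apply/card_gt1P => -[u [v []]].
rewrite !inE => /andP[uW hu] /andP[vW hv] nuv.
have [su [pu [qu [rcu du]]]] := dominating_split hu.
have [sv [pv [qv [rcv dv]]]] := dominating_split hv.
have nu : u != sv.
  by apply/eqP=> e; case: (nosplit _ hu); exists v, pv, qv; rewrite e.
have nv : v != su.
  by apply/eqP=> e; case: (nosplit _ hv); exists u, pu, qu; rewrite e.
have [/andP[svu nsvu]|nss] := boolP (connect A sv su && (sv != su)).
  have nss : ~~ (connect A su sv && (su != sv)).
    by apply: contraNN nsvu => /andP[suv _]; apply/eqP/connect_anti.
  have := notin_cycle_side rcu rcv _ nss; rewrite eq_sym => /(_ nuv)/negP[].
  exact: dominating_split_separates sF bW rcu du vW uW nv.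
have /negP[] := notin_cycle_side rcv rcu nuv nss.
exact: dominating_split_separates sF bW rcv dv uW vW nu.
Qed.

End ReticulationCycles.

Theorem theorem1 (S : Type) (N : network S) :
  level1 N <->
  one_nested N /\ (forall h : node N, hybrid h -> ~ split_node h).
Proof.
have [A_acyclic [r [_ r_uniq]]] :
  acyclic (@Defs.arc S N) /\ rooted (@Defs.arc S N) by case: N.
have root_connect x := rooted_connect A_acyclic x r_uniq.
split=> [l1|[nested nosplit]].
  by split=> [|h]; [exact: level1_one_nested|exact: level1_nosplit].
exact: nested_nosplit_level1 root_connect nested nosplit.
Qed.
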